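(* Let $I\subset(0,\infty)$ be an interval and let $f:I\to\mathbb{R}$ be differentiable on the interior $I^\circ$ of $I$. Let $m\in(0,1]$, $\alpha\in[0,1]$, $q>1$, $p$ with $\frac1p+\frac1q=1$, and $\theta>0$, and let $a,b$ be real numbers with $a<b$ and $a,\,b/m\in I^\circ$, such that $f'\in L[a,b]$. Suppose that $|f'|^q$ is harmonically $(\alpha,m)$-convex on $[a,b/m]$. Then $$\left|I_f(g;\theta,a,b)\right|\le \frac{a(b-a)}{2b}\left(\frac{1}{\theta p+1}\right)^{1/p}\left(\frac{|f'(a)|^q+m\alpha|f'(b/m)|^q}{\alpha+1}\right)^{1/q}\left[{}_2F_1\!\left(2p,\theta p+1;\theta p+2;1-\tfrac{a}{b}\right)^{1/p}+{}_2F_1\!\left(2p,1;\theta p+2;1-\tfrac{a}{b}\right)^{1/p}\right].$$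
   Context: A function $h:J\to\mathbb{R}$ on an interval $J\subset(0,\infty)$ is called harmonically $(\alpha,m)$-convex (with $\alpha\in[0,1]$, $m\in(0,1]$) if $h\left(\frac{mxy}{mty+(1-t)x}\right)\le t^{\alpha}h(x)+m(1-t^{\alpha})h(y)$ for all $x,y\in J$ and $t\in[0,1]$ (for which the left-hand side is defined, i.e. the argument lies in $J$). For $\varphi\in L[c,d]$ and $\theta>0$ the Riemann–Liouville integrals are $J^{\theta}_{c+}\varphi(x)=\frac{1}{\Gamma(\theta)}\int_c^x (x-t)^{\theta-1}\varphi(t)\,dt$ for $x>c$ and $J^{\theta}_{d-}\varphi(x)=\frac{1}{\Gamma(\theta)}\int_x^d (t-x)^{\theta-1}\varphi(t)\,dt$ for $x<d$, where $\Gamma$ is the Euler Gamma function. With $g(x)=1/x$, define $$I_f(g;\theta,a,b)=\frac{f(a)+f(b)}{2}-\frac{\Gamma(\theta+1)}{2}\left(\frac{ab}{b-a}\right)^{\theta}\left\{J^{\theta}_{1/a-}(f\circ g)(1/b)+J^{\theta}_{1/b+}(f\circ g)(1/a)\right\}.$$ The hypergeometric function is ${}_2F_1(a,b;c;z)=\frac{1}{\beta(b,c-b)}\int_0^1 t^{b-1}(1-t)^{c-b-1}(1-zt)^{-a}dt$ for $c>b>0$, $|z|<1$, where $\beta(x,y)=\int_0^1 t^{x-1}(1-t)^{y-1}dt$ is the Beta function. *)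

(* Defs.v *)
From HB Require Import structures.
From mathcomp Require Import all_boot all_order all_algebra.
From mathcomp Require Import all_classical all_reals all_analysis.
Set Implicit Arguments. Unset Strict Implicit. Unset Printing Implicit Defensive.
Import Order.TTheory GRing.Theory Num.Theory.
Import numFieldNormedType.Exports.
Local Open Scope classical_set_scope.
Local Open Scope ring_scope.

Section Defs.
Variable R : realType.
Notation mu := (@lebesgue_measure R).

Definition Gamma (x : R) : R :=
  Rintegral mu `]0, +oo[ (fun t => t `^ (x - 1) * expR (- t)).

Definition Beta (x y : R) : R :=
  Rintegral mu `]0, 1[ (fun t => t `^ (x - 1) * (1 - t) `^ (y - 1)).

(* Gauss hypergeometric function via Euler's integral representation
   (used for c > b > 0, |z| < 1) *)
Definition hyp2F1 (a b c z : R) : R :=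
  (Beta b (c - b))^-1 *
  Rintegral mu `]0, 1[
    (fun t => t `^ (b - 1) * (1 - t) `^ (c - b - 1) * (1 - z * t) `^ (- a)).

Definition RL_left (theta c : R) (phi : R -> R) (x : R) : R :=
  (Gamma theta)^-1 *
  Rintegral mu `]c, x[ (fun t => (x - t) `^ (theta - 1) * phi t).

Definition RL_right (theta d : R) (phi : R -> R) (x : R) : R :=
  (Gamma theta)^-1 *
  Rintegral mu `]x, d[ (fun t => (t - x) `^ (theta - 1) * phi t).

Definition harm_alpha_m_convex (alpha m : R) (h : R -> R) (J : set R) : Prop :=
  forall x y t, J x -> J y -> 0 <= t <= 1 ->
    J (m * x * y / (m * t * y + (1 - t) * x)) ->
    h (m * x * y / (m * t * y + (1 - t) * x))
      <= t `^ alpha * h x + m * (1 - t `^ alpha) * h y.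

(* I_f(g; theta, a, b) with g(x) = 1/x *)
Definition I_f (f : R -> R) (theta a b : R) : R :=
  (f a + f b) / 2 -
  Gamma (theta + 1) / 2 * (a * b / (b - a)) `^ theta *
  (RL_right theta a^-1 (f \o GRing.inv) b^-1 +
   RL_left theta b^-1 (f \o GRing.inv) a^-1).

End Defs.

(* Main.v *)
(** With [phi s = f (1/s)], [c = 1/b], [d = 1/a] and
    [K s = (s - c)^theta - (d - s)^theta], the recurrence
    [Gamma (theta + 1) = theta * Gamma theta] identifies
    [2 (d - c)^theta I_f] with the increment over [[c, d]] of [K phi - Psi],
    where [Psi] is a primitive of [K' phi]; its derivative is [K phi'].
    In the parameter [t], [s = t c + (1 - t) d], harmonic convexity bounds
    [|f'(1/s)|^q] by a continuous function of [t], so the mean value inequality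
    bounds that increment by the integral of a continuous function.  This
    requires no fundamental theorem of calculus for the possibly discontinuous
    [f'].  Hoelder's inequality then produces the two Euler integrals that
    define the hypergeometric values. *)

Require Import Defs.
From HB Require Import structures.
From mathcomp Require Import all_boot all_order all_algebra.
From mathcomp Require Import all_classical all_reals all_analysis.
From mathcomp Require Import measurable_realfun ring lra.
Set Implicit Arguments. Unset Strict Implicit. Unset Printing Implicit Defensive.
Import Order.TTheory GRing.Theory Num.Theory.
Import numFieldNormedType.Exports.
Local Open Scope classical_set_scope.
Local Open Scope ring_scope.

(** * Mean value inequality and fundamental theorem with endpoint singularities *)

Section calculus.
Context {R : realType}.
Notation mu := (@lebesgue_measure R).
Implicit Types (F G f g : R -> R) (u v x r : R).

(** For [s] equal to 1 or -1, [s F + G] has derivative [s f + g >= 0] and is therefore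
    nondecreasing. The two inequalities obtained are the two sides of the absolute value. *)
Lemma ler_dist_is_derive F G f g u v : u <= v ->
  {within `[u, v], continuous F} -> {within `[u, v], continuous G} ->
  {in `]u, v[, forall x, is_derive x 1 F (f x)} ->
  {in `]u, v[, forall x, is_derive x 1 G (g x)} ->
  {in `]u, v[, forall x, `|f x| <= g x} ->
  `|F v - F u| <= G v - G u.
Proof.
move=> uv cF cG dF dG fg.
have mono s : `|s| = 1 -> s * F u + G u <= s * F v + G v.
  move=> s1; have dH x : x \in `]u, v[ ->
      is_derive x 1 (s \*: F + G) (s * f x + g x).
    by move=> xuv; have ? := dF x xuv; have ? := dG x xuv; apply: is_deriveD.
  apply: (@ger0_derive1_ndecr _ (s \*: F + G) u v) => //.
  - by move=> x /dH[].
  - move=> x xuv; rewrite derive1E (@derive_val _ _ _ _ _ _ _ (dH x xuv)).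
    have : `|s * f x| <= g x by rewrite normrM s1 mul1r fg.
    by rewrite ler_norml => /andP[]; lra.
  - move=> x; apply: (@continuousD _ _ (subspace _)); last exact: cG.
    by apply: (@continuousZl_tmp _ _ (subspace `[u, v])) => /=; exact: cF.
have := mono 1 (normr1 _); have := mono (-1) (normrN1 _).
by rewrite ler_norml; lra.
Qed.

(** Continuity of [g] is asked on the open interval only, so that powers [(x - u)^(r - 1)] with
    [0 < r < 1], singular at an endpoint, are covered. *)
Lemma integrable_primitive g u v : u < v ->
  mu.-integrable `[u, v] (EFin \o g) -> {in `]u, v[, continuous g} ->
  exists G, [/\ {within `[u, v], continuous G},
    {in `]u, v[, forall x, is_derive x 1 G (g x)},
    G u = 0 & G v = \int[mu]_(t in `[u, v]) g t].
Proof.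
move=> uv ig cg; exists (fun x => \int[mu]_(t in `[u, x]) g t); split => //.
- exact: (parameterized_integral_continuous (ltW uv) ig).
- move=> x xuv; have [ux xv] : u < x /\ x < v.
    by move: xuv; rewrite in_itv/= => /andP[].
  have [dG <-] := continuous_FTC1_closed xv ig ux (cg x xuv).
  by rewrite derive1E; exact/derivableP.
- by rewrite set_itv1 Rintegral_set1.
Qed.

(** Only the majorant [g] is integrated, through its primitive; the derivative [f] may be
    discontinuous. *)
Lemma ler_dist_integral F f g u v : u < v ->
  {within `[u, v], continuous F} ->
  {in `]u, v[, forall x, is_derive x 1 F (f x)} ->
  mu.-integrable `[u, v] (EFin \o g) -> {in `]u, v[, continuous g} ->
  {in `]u, v[, forall x, `|f x| <= g x} ->
  `|F v - F u| <= \int[mu]_(t in `[u, v]) g t.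
Proof.
move=> uv cF dF ig cg fg.
have [G [cG dG Gu <-]] := integrable_primitive uv ig cg.
by rewrite -[G v]subr0 -Gu; apply: ler_dist_is_derive cF cG dF dG fg; exact: ltW.
Qed.

(** The difference of [F] and the integral primitive of [g] has derivative 0; comparing it with a
    constant function forces equal increments. *)
Lemma integrable_FTC2 F g u v : u < v ->
  {within `[u, v], continuous F} ->
  {in `]u, v[, forall x, is_derive x 1 F (g x)} ->
  mu.-integrable `[u, v] (EFin \o g) -> {in `]u, v[, continuous g} ->
  \int[mu]_(t in `[u, v]) g t = F v - F u.
Proof.
move=> uv cF dF ig cg.
have [G [cG dG Gu <-]] := integrable_primitive uv ig cg.
have : `|(F \- G) v - (F \- G) u| <= (cst 0 : R -> R) v - (cst 0 : R -> R) u.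
  apply: (@ler_dist_is_derive _ _ (fun=> 0) (fun=> 0)); first exact: ltW.
  - by move=> x; apply: (@continuousB _ _ (subspace _)); [exact: cF|exact: cG].
  - by move=> x; exact: cst_continuous.
  - move=> x xuv; have ? := dF x xuv; have ? := dG x xuv.
    by rewrite -(subrr (g x)); apply: is_deriveB.
  - by move=> x _; exact: is_derive_cst.
  - by move=> x _; rewrite normr0.
by rewrite /= subrr normr_le0 Gu => /eqP; lra.
Qed.

(** On compact segments inside []u, v[] the integral of [g] is an increment of the nondecreasing
    [F], hence at most [F v - F u]. Monotone convergence along an exhaustion carries this bound to
    the whole interval. *)
Lemma ge0_FTC_integrable F g u v : u < v ->
  {within `[u, v], continuous F} ->
  {in `]u, v[, forall x, is_derive x 1 F (g x)} ->
  {in `]u, v[, continuous g} -> {in `]u, v[, forall x, 0 <= g x} ->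
  mu.-integrable `[u, v] (EFin \o g).
Proof.
move=> uv cF dF cg g0.
have mg : measurable_fun `]u, v[ g.
  apply: open_continuous_measurable_fun; first exact: interval_open.
  by move=> x /set_mem xuv; exact: cg.
have mgcc := measurable_fun_itv_cc mg.
apply/integrableP; split; first exact/measurable_EFinP.
(* The witness is [e n = 1 / (n + 1)], known below only through these three properties. *)
have [e [e0 ndE ecvg]] : exists e : nat -> R, [/\ forall n, 0 < e n,
    forall n k, (n <= k)%N -> e k <= e n &
    forall r, 0 < r -> exists n, e n < r].
  exists (fun n => n.+1%:R^-1); split=> [n|n k nk|r r0].
  - by rewrite invr_gt0.
  - by rewrite lef_pV2 ?posrE// ler_nat.
  - by near \oo => n; exists n; near: n; exact: near_infty_natSinv_lt (PosNum r0).
pose E n := `[u + e n, v - e n]%classic.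
have EE : `]u, v[%classic = \bigcup_n E n.
  apply/seteqP; split=> [x /=|x [n _]]; rewrite /E /= !in_itv/=.
    move=> /andP[ux xv].
    have [|n] := ecvg (Num.min (x - u) (v - x)).
      by rewrite lt_min !subr_gt0 ux.
    rewrite lt_min => /andP[h1 h2]; exists n => //.
    by rewrite /= in_itv/=; lra.
  by have := e0 n; lra.
have subE n x : E n x -> x \in `]u, v[.
  by move=> Enx; rewrite inE; have : `]u, v[%classic x by rewrite EE; exists n.
have ndF : {in `[u, v] &, {homo F : x y / x <= y}}.
  apply: ger0_derive1_le_cc => // x xuv; first by case: (dF x xuv).
  by rewrite derive1E (@derive_val _ _ _ _ _ _ _ (dF x xuv)) g0.
have leE n : (\int[mu]_(x in E n) (g x)%:E <= (F v - F u)%:E)%E.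
  have Fuv : F u <= F v by apply: ndF; rewrite ?in_itv/= ?lexx ?ltW.
  have e0n := e0 n.
  (* For small [n] the segment may degenerate to a point or to the empty set; its integral is then
     0. *)
  have [lt|ge] := ltP (u + e n) (v - e n); last first.
    have [E0|->] : E n = set0 \/ E n = [set u + e n].
      move: ge; rewrite le_eqVlt => /predU1P[h|h]; [right|left].
        by rewrite /E h set_itv1.
      by rewrite /E set_itv_ge// bnd_simp -ltNge.
    - by rewrite E0 integral_set0 lee_fin subr_ge0.
    - by rewrite integral_set1 lee_fin subr_ge0.
  have sub x : x \in `[u + e n, v - e n] -> x \in `]u, v[.
    by move=> xE; apply: (@subE n).
  have sub' x : x \in `]u + e n, v - e n[ -> x \in `]u, v[.
    by move=> xE; apply/sub/subset_itv_oo_cc.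
  have cgE : {within E n, continuous g}.
    by apply: continuous_in_subspaceT => x /set_mem /sub; exact: cg.
  have igE : mu.-integrable (E n) (EFin \o g).
    by apply: continuous_compact_integrable => //; exact: segment_compact.
  have /fineK <- : (\int[mu]_(x in E n) (g x)%:E)%E \is a fin_num.
    by apply: integrable_fin_num => //; exact: measurable_itv.
  rewrite lee_fin [leLHS](@integrable_FTC2 F g)//.
  - by rewrite lerB//; apply: ndF; rewrite ?in_itv/=; lra.
  - by apply: continuous_subspaceW cF => x /sub; exact: subset_itv_oo_cc.
  - by move=> x /sub'; exact: dF.
  - by move=> x /sub'; exact: cg.
have cv : \int[mu]_(x in E n) (g x)%:E @[n --> \oo]%E -->
    (\int[mu]_(x in \bigcup_n E n) (g x)%:E)%E.
  apply: ge0_nondecreasing_set_cvg_integral => //.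
  - move=> n k nk; apply/subsetPset => x; rewrite /E /= !in_itv/=.
    by have := ndE _ _ nk; lra.
  - by move=> n; exact: measurable_itv.
  - move=> n; apply/measurable_EFinP; apply: measurable_funS mg => // x.
    by move=> /subE; rewrite inE.
  - by move=> n x /subE xuv; rewrite lee_fin g0.
rewrite (@integral_itv_bndoo _ _ _ (fun x => `|(EFin \o g) x|%E)); last first.
  exact/measurableT_comp/measurable_EFinP.
rewrite [ltLHS](_ : _ = \int[mu]_(x in `]u, v[) (g x)%:E)%E; last first.
  by apply: eq_integral => x /set_mem/= xuv; rewrite ger0_norm// g0.
rewrite EE -(cvg_lim _ cv)//; apply: (@le_lt_trans _ _ (F v - F u)%:E).
  by apply: lime_le; [exact: cvgP cv|exact: nearW].
by rewrite ltry.
Unshelve. all: by end_near. Qed.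
End calculus.

(** * Continuity, derivatives and integrals of real powers *)

Section power_functions.
Context {R : realType}.
Notation mu := (@lebesgue_measure R).
Implicit Types (F G f g : R -> R) (u v x r : R).

Lemma is_derive1_continuous F x df : is_derive x 1 F df ->
  continuous_at x F.
Proof. by case=> /derivable1_diffP/differentiable_continuous. Qed.

Lemma powR_continuous_gt0 r x : 0 < x -> continuous_at x (@powR R ^~ r).
Proof. by move=> x0; exact: is_derive1_continuous (is_derive1_powR r x0). Qed.

(** At negative bases [powR] takes a default value, which breaks its continuity at 0 for [r > 0].
    The power of [|y|] agrees with it for [y > 0] and stays continuous across 0, so it serves as the
    primitive from here on. *)
Lemma is_derive1_normr_powR r x : 0 < x ->
  is_derive x 1 (fun y => `|y| `^ r) (r * x `^ (r - 1)).
Proof.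
move=> x0; apply: near_eq_is_derive (is_derive1_powR r x0).
by near=> y; rewrite ger0_norm// ltW//; near: y; exact: lt_nbhsr.
Unshelve. all: by end_near. Qed.

Lemma continuous_normr_powR r : 0 <= r -> continuous (fun y : R => `|y| `^ r).
Proof.
rewrite le_eqVlt => /predU1P[<- x|r0 x].
  (* The convention [0^0 = 1] makes the function constant at exponent 0. *)
  rewrite (_ : (fun y : R => `|y| `^ 0) = cst 1); first exact: cst_continuous.
  by apply/funext => y; rewrite powRr0.
have [->|x0] := eqVneq x 0; last first.
  apply: (@continuous_comp R R R (fun y : R => `|y|) (@powR R ^~ r)).
    exact: norm_continuous.
  by apply: powR_continuous_gt0; rewrite normr_gt0.
apply/cvgrPdist_lt => e e0.
(* The radius at 0 is the preimage of [e] under the [r]-th power. *)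
have d0 : 0 < e `^ r^-1 by rewrite powR_gt0.
near=> y; rewrite normr0 powR0 ?gt_eqF// sub0r normrN ger0_norm ?powR_ge0//.
have -> : e = (e `^ r^-1) `^ r by rewrite -powRrM mulVf ?gt_eqF// powRr1 ?ltW.
apply: gt0_ltr_powR; [by []|by []|exact/ltW|].
by near: y; exists (e `^ r^-1) => //= z; rewrite /ball_/= sub0r normrN.
Unshelve. all: by end_near. Qed.

Lemma continuous_normr_powR_comp r g x : 0 <= r -> continuous_at x g ->
  continuous_at x (fun y => `|g y| `^ r).
Proof.
move=> r0 cg; apply: (@continuous_comp R R R g (fun y => `|y| `^ r)) => //.
exact: continuous_normr_powR.
Qed.

Lemma continuous_powR_comp r g x : 0 < g x -> continuous_at x g ->
  continuous_at x (fun y => g y `^ r).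
Proof.
move=> gx cg; apply: (@continuous_comp R R R g (@powR R ^~ r)) => //.
exact: powR_continuous_gt0.
Qed.

Lemma is_derive1_subl u x : is_derive x 1 (fun y : R => y - u) 1.
Proof. exact: is_derive_shift. Qed.

Lemma is_derive1_subr v x : is_derive x 1 (fun y : R => v - y) (-1).
Proof. by rewrite -[-1]add0r; apply: is_deriveB. Qed.

Lemma is_derive1_normr_powR_subl r u x : u < x ->
  is_derive x 1 (fun y => `|y - u| `^ r) (r * (x - u) `^ (r - 1)).
Proof.
move=> ux; have xu : 0 < x - u by rewrite subr_gt0.
have := @is_derive1_comp R (fun y => `|y| `^ r) (fun y => y - u) x _ _
  (is_derive1_normr_powR r xu) (is_derive1_subl u x).
by rewrite mulr1.
Qed.

Lemma is_derive1_normr_powR_subr r v x : x < v ->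
  is_derive x 1 (fun y => `|v - y| `^ r) (- (r * (v - x) `^ (r - 1))).
Proof.
move=> xv; have vx : 0 < v - x by rewrite subr_gt0.
have := @is_derive1_comp R (fun y => `|y| `^ r) (fun y => v - y) x _ _
  (is_derive1_normr_powR r vx) (is_derive1_subr v x).
by rewrite mulrN1.
Qed.

Lemma continuous_normr_powR_subl r u : 0 <= r ->
  continuous (fun y => `|y - u| `^ r).
Proof.
move=> r0 x; apply: continuous_normr_powR_comp => //.
exact: is_derive1_continuous (is_derive1_subl u x).
Qed.

Lemma continuous_normr_powR_subr r v : 0 <= r ->
  continuous (fun y => `|v - y| `^ r).
Proof.
move=> r0 x; apply: continuous_normr_powR_comp => //.
exact: is_derive1_continuous (is_derive1_subr v x).
Qed.

Lemma continuous_powR_subl r u x : u < x ->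
  continuous_at x (fun y => (y - u) `^ r).
Proof.
move=> ux; apply: (@continuous_powR_comp r (fun y => y - u) x); first by rewrite subr_gt0.
exact: is_derive1_continuous (is_derive1_subl u x).
Qed.

Lemma continuous_powR_subr r v x : x < v ->
  continuous_at x (fun y => (v - y) `^ r).
Proof.
move=> xv; apply: (@continuous_powR_comp r (fun y => v - y) x); first by rewrite subr_gt0.
exact: is_derive1_continuous (is_derive1_subr v x).
Qed.

Lemma continuousM_fun f g x : continuous_at x f -> continuous_at x g ->
  continuous_at x (fun y => f y * g y).
Proof. exact: continuousM. Qed.

Lemma continuousD_fun f g x : continuous_at x f -> continuous_at x g ->
  continuous_at x (fun y => f y + g y).
Proof. exact: continuousD. Qed.

Lemma continuousB_fun f g x : continuous_at x f -> continuous_at x g ->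
  continuous_at x (fun y => f y - g y).
Proof. exact: continuousB. Qed.

Lemma is_derive1B_fun f g x df dg : is_derive x 1 f df -> is_derive x 1 g dg ->
  is_derive x 1 (fun y => f y - g y) (df - dg).
Proof. exact: is_deriveB. Qed.

Lemma is_derive1M_fun f g x df dg : is_derive x 1 f df -> is_derive x 1 g dg ->
  is_derive x 1 (fun y => f y * g y) (f x * dg + g x * df).
Proof. exact: is_deriveM. Qed.

Lemma is_derive1Zl k f x df : is_derive x 1 f df ->
  is_derive x 1 (fun y => k * f y) (k * df).
Proof. exact: is_deriveZ. Qed.

(** For [r < 1] the integrand is unbounded near [u]. Up to the factor [r] it is the nonnegative
    derivative of a continuous power, which yields integrability. *)
Lemma integrable_powR_subl r u v : 0 < r -> u < v ->
  mu.-integrable `[u, v] (EFin \o (fun x => (x - u) `^ (r - 1))).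
Proof.
move=> r0 uv.
suff : mu.-integrable `[u, v] (EFin \o (fun x => r * (x - u) `^ (r - 1))).
  move=> ir; apply: eq_integrable (integrableZl _ r^-1 ir) => //.
  by move=> x _ /=; rewrite -EFinM mulKf// gt_eqF.
apply: (@ge0_FTC_integrable _ (fun x => `|x - u| `^ r)) => //.
- by apply/continuous_subspaceT/continuous_normr_powR_subl; exact: ltW.
- by move=> x; rewrite in_itv/= => /andP[ux _]; exact: is_derive1_normr_powR_subl.
- move=> x; rewrite in_itv/= => /andP[ux _].
  by apply: continuousM_fun; [exact: cst_continuous|exact: continuous_powR_subl].
- by move=> x _; rewrite mulr_ge0 ?powR_ge0// ltW.
Qed.

Lemma integrable_powR_subr r u v : 0 < r -> u < v ->
  mu.-integrable `[u, v] (EFin \o (fun x => (v - x) `^ (r - 1))).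
Proof.
move=> r0 uv.
suff : mu.-integrable `[u, v] (EFin \o (fun x => r * (v - x) `^ (r - 1))).
  move=> ir; apply: eq_integrable (integrableZl _ r^-1 ir) => //.
  by move=> x _ /=; rewrite -EFinM mulKf// gt_eqF.
(* The factor -1 makes the decreasing power increasing, so that its derivative is nonnegative. *)
apply: (@ge0_FTC_integrable _ (fun x => -1 * `|v - x| `^ r)) => //.
- apply: continuous_subspaceT => x.
  apply: continuousM_fun; first exact: cst_continuous.
  by apply: continuous_normr_powR_subr; exact: ltW.
- move=> x; rewrite in_itv/= => /andP[_ xv].
  apply: is_derive_eq (is_derive1Zl (-1) (is_derive1_normr_powR_subr r xv)) _.
  by rewrite mulN1r opprK.
- move=> x; rewrite in_itv/= => /andP[_ xv].
  by apply: continuousM_fun; [exact: cst_continuous|exact: continuous_powR_subr].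
- by move=> x _; rewrite mulr_ge0 ?powR_ge0// ltW.
Qed.

Lemma Rintegral_powR_subl r u v : 0 < r -> u < v ->
  \int[mu]_(x in `[u, v]) (x - u) `^ (r - 1) = (v - u) `^ r / r.
Proof.
move=> r0 uv; rewrite (@integrable_FTC2 _ (fun x => r^-1 * `|x - u| `^ r))//.
- rewrite subrr normr0 powR0 ?gt_eqF// mulr0 subr0 mulrC gtr0_norm//.
  by rewrite subr_gt0.
- apply: continuous_subspaceT => x.
  apply: continuousM_fun; first exact: cst_continuous.
  by apply: continuous_normr_powR_subl; exact: ltW.
- move=> x; rewrite in_itv/= => /andP[ux _].
  apply: is_derive_eq (is_derive1Zl r^-1 (is_derive1_normr_powR_subl r ux)) _.
  by rewrite mulKf// gt_eqF.
- exact: integrable_powR_subl.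
- by move=> x; rewrite in_itv/= => /andP[ux _]; exact: continuous_powR_subl.
Qed.

Lemma Rintegral_powR_subr r u v : 0 < r -> u < v ->
  \int[mu]_(x in `[u, v]) (v - x) `^ (r - 1) = (v - u) `^ r / r.
Proof.
move=> r0 uv; rewrite (@integrable_FTC2 _ (fun x => - r^-1 * `|v - x| `^ r))//.
- rewrite subrr normr0 powR0 ?gt_eqF// mulr0 sub0r mulNr opprK mulrC.
  by rewrite gtr0_norm// subr_gt0.
- apply: continuous_subspaceT => x.
  apply: continuousM_fun; first exact: cst_continuous.
  by apply: continuous_normr_powR_subr; exact: ltW.
- move=> x; rewrite in_itv/= => /andP[_ xv].
  apply: is_derive_eq (is_derive1Zl (- r^-1) (is_derive1_normr_powR_subr r xv)) _.
  by rewrite mulrNN mulKf// gt_eqF.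
- exact: integrable_powR_subr.
- by move=> x; rewrite in_itv/= => /andP[_ xv]; exact: continuous_powR_subr.
Qed.

End power_functions.

(** * Convergence, positivity and recurrence of the Gamma function *)

Section gamma.
Context {R : realType}.
Notation mu := (@lebesgue_measure R).
Implicit Types (r t : R).

(** Raise [x <= 1 + x <= exp x] at [x = t / (2 r)] to the power [r]. Half of the decay of
    [exp (- t)] absorbs the power; the other half remains available. *)
Lemma powR_expR_half_le r t : 0 < r -> 0 <= t ->
  t `^ r * expR (- (t / 2)) <= (2 * r) `^ r.
Proof.
move=> r0 t0; have r20 : 0 < 2 * r by rewrite mulr_gt0.
have le1 : t / (2 * r) <= expR (t / (2 * r)).
  by apply: le_trans (expR_ge1Dx _); rewrite lerDr.
have : (t / (2 * r)) `^ r <= expR (t / (2 * r)) `^ r.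
  apply: ge0_ler_powR => //; rewrite ?nnegrE; first exact: ltW.
  - by rewrite divr_ge0// ltW.
  - exact: expR_ge0.
rewrite -expRM (_ : t / (2 * r) * r = t / 2); last by field; rewrite gt_eqF.
move=> le2; rewrite expRN ler_pdivrMr ?expR_gt0//.
have -> : t `^ r = (t / (2 * r)) `^ r * (2 * r) `^ r.
  by rewrite -powRM ?divfK ?gt_eqF ?divr_ge0// ltW.
by rewrite mulrC ler_wpM2l// powR_ge0.
Qed.

Lemma gamma_integrand_continuous r t : 0 < t ->
  continuous_at t (fun t => t `^ (r - 1) * expR (- t)).
Proof.
move=> t0; apply: continuousM_fun; first exact: powR_continuous_gt0.
apply: (@continuous_comp R R R -%R expR); first exact: opp_continuous.
exact: continuous_expR.
Qed.

Lemma integrable_gamma r : 0 < r ->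
  mu.-integrable `[0, +oo[ (EFin \o (fun t => t `^ (r - 1) * expR (- t))).
Proof.
move=> r0.
(* The dominating function is the power alone on [[0, 1]], plus [(2 r)^r exp (- t / 2)]. The second
   term is a multiple of the exponential density of rate 1/2; the constant 2 cancels the factor 1/2
   of that density. *)
pose h t : R := ((fun t => (t - 0) `^ (r - 1)) \_ `[0, 1]) t +
  2 * (2 * r) `^ r * exponential_pdf 2^-1 t.
apply: (@le_integrable _ _ _ mu _ _ _ (EFin \o h)) => //.
- apply/measurable_EFinP/measurable_funTS; apply: measurable_funM.
    exact: measurable_powR.
  exact: measurableT_comp.
- move=> t /=; rewrite in_itv/= andbT => t0.
  rewrite lee_fin ger0_norm; last by rewrite mulr_ge0 ?powR_ge0 ?expR_ge0.
  apply: le_trans (ler_norm _); rewrite /h patchE subr0 exponential_pdfE//.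
  have -> : 2 * (2 * r) `^ r * (2^-1 * expR (- 2^-1 * t)) =
      (2 * r) `^ r * expR (- (t / 2)) by rewrite mulNr [_^-1 * t]mulrC; field.
  case: ifPn => [_|].
    rewrite -[leLHS]addr0 lerD//.
      by rewrite ler_piMr ?powR_ge0// expR_le1// oppr_le0.
    by rewrite mulr_ge0 ?powR_ge0 ?expR_ge0.
  rewrite notin_setE /= in_itv/= t0/= => /negP; rewrite -ltNge => t1.
  (* For [t > 1], one factor absorbs [t^(r - 1) <= t^r] and the other is the density. *)
  have -> : expR (- t) = expR (- (t / 2)) * expR (- (t / 2)).
    by rewrite -expRD; congr expR; field.
  rewrite add0r mulrA ler_wpM2r ?expR_ge0//.
  apply: le_trans (powR_expR_half_le r0 t0); rewrite ler_wpM2r ?expR_ge0//.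
  by rewrite ler_powR ?ltW// gtrBl.
- have ih : mu.-integrable setT (EFin \o h).
    have i1 : mu.-integrable setT
        (EFin \o ((fun t => (t - 0) `^ (r - 1)) \_ `[0, 1])).
      rewrite -restrict_EFin; apply: (integrable_mkcond _ _).1 => //.
      exact: integrable_powR_subl.
    have i2 := integrable_exponential_pdf (rate := 2^-1 : R).
    have {}i2 := integrableZl _ (2 * (2 * r) `^ r) (i2 _).
    by apply: eq_integrable (integrableD _ i1 (i2 _ _)) => //; rewrite invr_gt0.
  exact: integrableS ih.
Qed.

Lemma Gamma_itvE r : 0 < r ->
  Gamma r = \int[mu]_(t in `[0, +oo[) (t `^ (r - 1) * expR (- t)).
Proof.
move=> r0; rewrite /Gamma Rintegral_itv_obnd_cbnd//.
apply: integrableS (integrable_gamma r0) => // t /=.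
by rewrite !in_itv/= !andbT; exact: ltW.
Qed.

(** On [[1, 2]] the integrand is at least [exp (- 2) / 2], because [t^(r - 1) = t^r / t] with
    [t^r >= 1] and [t <= 2]. *)
Lemma Gamma_gt0 r : 0 < r -> 0 < Gamma r.
Proof.
move=> r0; rewrite Gamma_itvE//.
have ig := integrable_gamma r0.
have i12 : mu.-integrable `[1, 2] (EFin \o (fun t => t `^ (r - 1) * expR (- t))).
  by apply: integrableS ig => // t /=; rewrite !in_itv/=; lra.
apply: (@lt_le_trans _ _
  (\int[mu]_(t in `[1, 2]) (t `^ (r - 1) * expR (- t)))).
  apply: (@lt_le_trans _ _ (\int[mu]_(t in `[1, 2]) (2^-1 * expR (- 2)))).
    rewrite Rintegral_cst//.
    have : mu `[1, 2] = 1%:E.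
      by rewrite lebesgue_measure_itv/= lte_fin ltr1n -EFinD; congr _%:E; ring.
    by move=> /= ->; rewrite mulr1 mulr_gt0 ?invr_gt0 ?expR_gt0.
  apply: le_Rintegral => //.
    apply: continuous_compact_integrable; first exact: segment_compact.
    by apply: continuous_subspaceT => x; exact: cst_continuous.
  move=> t; rewrite /= in_itv/= => /andP[t1 t2].
  have t0 : 0 < t by lra.
  apply: ler_pM; rewrite ?expR_ge0 ?ler_expR ?lerN2//.
  rewrite powRB; last by apply/implyP => _; rewrite gt_eqF.
  rewrite powRr1; last exact: ltW.
  rewrite ler_pdivlMr// (@le_trans _ _ 1)//; first by lra.
  have : 1 `^ r <= t `^ r.
    by apply: ge0_ler_powR => //; rewrite ?nnegrE//; exact: ltW.
  by rewrite powR1.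
rewrite fine_le ?integrable_fin_num//.
apply: ge0_subset_integral => //.
- by case/integrableP : ig.
- by move=> t _; rewrite lee_fin mulr_ge0 ?powR_ge0 ?expR_ge0.
- by move=> t /=; rewrite !in_itv/=; lra.
Qed.

(** The function [- t^r exp (- t)] is a primitive of the difference of the two integrands and
    vanishes both at 0 and at infinity. *)
Lemma GammaD1 r : 0 < r -> Gamma (r + 1) = r * Gamma r.
Proof.
move=> r0; have r10 : 0 < r + 1 by rewrite ltr_wpDr.
pose k t : R := t `^ r * expR (- t) - r * (t `^ (r - 1) * expR (- t)).
pose F t : R := - 1 * (`|t| `^ r * expR (- t)).
have ig := integrable_gamma r0.
have ig1 : mu.-integrable `[0, +oo[ (EFin \o (fun t => t `^ r * expR (- t))).
  by have := integrable_gamma r10; rewrite addrK.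
have igr : mu.-integrable `[0, +oo[ (EFin \o (fun t => r * (t `^ (r - 1) * expR (- t)))).
  by apply: eq_integrable (integrableZl _ r ig).
have ik : mu.-integrable `[0, +oo[ (EFin \o k).
  by apply: eq_integrable (integrableB _ ig1 igr) => //.
have dE t : is_derive t 1 (fun t : R => expR (- t)) (- expR (- t)).
  apply: is_derive_eq (@is_derive1_comp R expR -%R t _ _ _ _) _.
  by rewrite mulrN1.
have dF t : 0 < t -> is_derive t 1 F (k t).
  move=> t0; apply: is_derive_eq (is_derive1Zl (-1)
    (is_derive1M_fun (is_derive1_normr_powR r t0) (dE t))) _.
  by rewrite /k gtr0_norm//; ring.
have ck t : 0 < t -> continuous_at t k.
  move=> t0; apply: continuousB_fun.
    by have := @gamma_integrand_continuous (r + 1) t t0; rewrite addrK.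
  apply: continuousM_fun; first exact: cst_continuous.
  exact: gamma_integrand_continuous.
have cF : continuous F.
  move=> t; apply: continuousM_fun; first exact: cst_continuous.
  apply: continuousM_fun; last exact: is_derive1_continuous (dE t).
  by apply: continuous_normr_powR; exact: ltW.
suff : \int[mu]_(t in `[0, +oo[) k t = 0.
  rewrite /k RintegralB// RintegralZl// => /eqP.
  by rewrite subr_eq0 -(Gamma_itvE r0) => /eqP <-; rewrite Gamma_itvE// addrK.
(* [k t] has the sign of [t - r] for [t > 0]. Cutting at [r] leaves a half-line with a nonnegative
   integrand, fit for the improper fundamental theorem, and a bounded interval containing the
   possible singularity at 0. *)
rewrite (@itv_bndbnd_setU _ _ _ (BLeft r))//= ?bnd_simp ?ltW//.
rewrite Rintegral_setU//=; last 2 first.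
- rewrite -itv_bndbnd_setU//= ?bnd_simp ?ltW//.
- apply/disj_setPS => t [] /=; rewrite !in_itv/=; lra.
rewrite Rintegral_itv_bndo_bndc; last first.
  by apply: integrableS ik => // t /=; rewrite !in_itv/=; lra.
rewrite (@integrable_FTC2 _ F)//; last 4 first.
- exact: continuous_subspaceT.
- by move=> t; rewrite in_itv/= => /andP[t0 _]; exact: dF.
- by apply: integrableS ik => // t /=; rewrite !in_itv/=; lra.
- by move=> t; rewrite in_itv/= => /andP[t0 _]; exact: ck.
rewrite (@Rintegral_ge0_continuous_FTC2y _ k F r 0)//.
- by rewrite /F normr0 powR0 ?gt_eqF// mul0r mulr0; ring.
- move=> t rt; have t0 : 0 < t by exact: lt_le_trans rt.
  rewrite /k -(mulr_powRB1 (ltW t0) r0) -mulrA -mulrBl mulr_ge0 ?subr_ge0//.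
  by rewrite mulr_ge0 ?powR_ge0 ?expR_ge0.
- apply: continuous_in_subspaceT => t /set_mem/=; rewrite in_itv/= andbT => rt.
  by apply: ck; exact: lt_le_trans rt.
- apply/cvgrPdist_lt => e e0.
  (* [C] bounds [t^(r + 1) exp (- t)], whence [|F t| <= C / t] for [t > 0]. *)
  pose C : R := (2 * (r + 1)) `^ (r + 1).
  near=> t; have t0 : 0 < t by near: t; apply: nbhs_pinfty_gt; exact: num_real.
  rewrite sub0r normrN /F mulN1r normrN ger0_norm; last first.
    by rewrite mulr_ge0 ?powR_ge0 ?expR_ge0.
  rewrite gtr0_norm// -(ltr_pM2l t0) mulrA.
  have -> : t * t `^ r = t `^ (r + 1).
    by rewrite -(mulr_powRB1 (ltW t0) r10) addrK.
  apply: (@le_lt_trans _ _ C).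
    apply: le_trans (powR_expR_half_le r10 (ltW t0)).
    by rewrite ler_wpM2l ?powR_ge0// ler_expR; lra.
  by rewrite -ltr_pdivrMr//; near: t; apply: nbhs_pinfty_gt; exact: num_real.
- by move=> t rt; case: (dF t (lt_trans r0 rt)).
- exact: cvg_at_right_filter (cF r).
- move=> t; rewrite in_itv/= andbT => rt; rewrite derive1E.
  exact: (@derive_val _ _ _ _ _ _ _ (dF t (lt_trans r0 rt))).
Unshelve. all: by end_near. Qed.

End gamma.

(** * Hoelder's inequality on a measurable set *)

Section hoelder_inequality.
Context {R : realType}.
Notation mu := (@lebesgue_measure R).
Implicit Types (D : set R) (f g : R -> R) (p q : R).

(** [Lnorm] integrates over the whole line, so [f] is extended by 0 outside [D]; [0^p = 0] for
    [p > 0] leaves the integral unchanged. *)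
Lemma Lnorm_patch_Rintegral D f p : measurable D -> 0 < p ->
  (forall x, D x -> 0 <= f x) ->
  mu.-integrable D (EFin \o (fun x => f x `^ p)) ->
  Lnorm mu p%:E (EFin \o (f \_ D)) =
    ((\int[mu]_(x in D) f x `^ p) `^ (1 / p))%:E.
Proof.
move=> mD p0 f0 ifp; rewrite Lnorm.unlock -poweR_EFin /Rintegral fineK; last first.
  exact: integrable_fin_num.
rewrite div1r [in RHS]integral_mkcond; congr (_ `^ _)%E.
apply: eq_integral => x _; rewrite /= patchE [in RHS]patchE.
case: ifPn => [/set_mem Dx|_]; last by rewrite normr0 powR0 ?gt_eqF.
by rewrite ger0_norm// f0.
Qed.

Lemma Rintegral_hoelder D f g p q : measurable D ->
  measurable_fun D f -> measurable_fun D g ->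
  (forall x, D x -> 0 <= f x) -> (forall x, D x -> 0 <= g x) ->
  0 < p -> 0 < q -> p^-1 + q^-1 = 1 ->
  mu.-integrable D (EFin \o (fun x => f x `^ p)) ->
  mu.-integrable D (EFin \o (fun x => g x `^ q)) ->
  mu.-integrable D (EFin \o (fun x => f x * g x)) ->
  \int[mu]_(x in D) (f x * g x) <=
  (\int[mu]_(x in D) f x `^ p) `^ (1 / p) *
  (\int[mu]_(x in D) g x `^ q) `^ (1 / q).
Proof.
move=> mD mf mg f0 g0 p0 q0 pq ifp igq ifg.
have mf' : measurable_fun setT (f \_ D) by exact/(measurable_restrictT _ _).1.
have mg' : measurable_fun setT (g \_ D) by exact/(measurable_restrictT _ _).1.
have := hoelder mu mf' mg' p0 q0 pq.
rewrite (Lnorm_patch_Rintegral mD p0 f0 ifp) (Lnorm_patch_Rintegral mD q0 g0 igq).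
rewrite -EFinM -lee_fin; apply: le_trans.
rewrite Lnorm1 /Rintegral fineK; last exact: integrable_fin_num.
rewrite [leLHS]integral_mkcond le_eqVlt; apply/orP; left; apply/eqP.
apply: eq_integral => x _; rewrite /= patchE !patchE.
case: ifPn => [/set_mem Dx|_]; last by rewrite mulr0 normr0.
by rewrite ger0_norm// mulr_ge0 ?f0 ?g0.
Qed.

End hoelder_inequality.

(** * Fractional trapezoid estimate on a segment *)

Section fractional_trapezoid.
Context {R : realType}.
Notation mu := (@lebesgue_measure R).
Implicit Types (F f g phi s : R -> R) (u v x r : R).

Lemma within_continuous_comp_sub (A B : set R) F s :
  {within B, continuous F} -> continuous s -> (forall x, A x -> B (s x)) ->
  {within A, continuous (F \o s)}.
Proof.
move=> /subspace_continuousP cF cs AB; apply/subspace_continuousP => x Ax.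
apply: cvg_comp (cF (s x) (AB x Ax)) => P nP.
apply: (@filterS _ (nbhs x) _ _ _ _ (cs x _ nP)) => y BP Ay.
exact: BP (AB y Ay).
Qed.

Lemma Rintegral_itv_oo_cc f u v : mu.-integrable `[u, v] (EFin \o f) ->
  \int[mu]_(x in `]u, v[) f x = \int[mu]_(x in `[u, v]) f x.
Proof.
move=> fi; rewrite Rintegral_itv_bndo_bndc ?Rintegral_itv_obnd_cbnd//.
  by apply: integrableS fi => //; exact: subset_itv_oc_cc.
by apply: integrableS fi => //; exact: subset_itv_oo_cc.
Qed.

Lemma integrable_continuous_itv f u v : {in `[u, v], continuous f} ->
  mu.-integrable `[u, v] (EFin \o f).
Proof.
move=> cf; apply: continuous_compact_integrable; first exact: segment_compact.
by apply: continuous_in_subspaceT => x /set_mem; exact: cf.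
Qed.

Lemma integrableM_continuous f phi u v : {in `[u, v], continuous phi} ->
  mu.-integrable `[u, v] (EFin \o f) ->
  mu.-integrable `[u, v] (EFin \o (fun x => f x * phi x)).
Proof.
move=> cphi fi; have cw : {within `[u, v], continuous phi}.
  by apply: continuous_in_subspaceT => x /set_mem; exact: cphi.
apply: eq_integrable (integrableMl _ fi _ _) => //.
  exact: subspace_continuous_measurable_fun.
have := compact_bounded (continuous_compact cw (@segment_compact _ u v)).
move=> [M [Mreal bM]]; exists M; split=> // N MN x xuv.
by apply: bM MN _ _; exists x.
Qed.

(** The weight [t^theta + (1 - t)^theta] majorizes [|K|] divided by [(d - c)^theta]. The constant
    [(d - c) / 2] combines the speed [d - c] of the parametrization with the halving in the
    trapezoid term. *)
Lemma fractional_trapezoid_le (theta c d : R) phi (dphi : R -> R) g : 0 < theta -> c < d ->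
  {in `[c, d], forall x, is_derive x 1 phi (dphi x)} ->
  {in `[0, 1], continuous g} ->
  {in `]0, 1[, forall t, (t `^ theta + (1 - t) `^ theta) *
    `|dphi (t * c + (1 - t) * d)| <= g t} ->
  `|(phi c + phi d) / 2 - theta / 2 * ((d - c) `^ theta)^-1 *
     (\int[mu]_(x in `]c, d[) ((x - c) `^ (theta - 1) * phi x) +
      \int[mu]_(x in `]c, d[) ((d - x) `^ (theta - 1) * phi x))|
  <= (d - c) / 2 * \int[mu]_(t in `[0, 1]) g t.
Proof.
move=> th0 cd dphiP cg gP.
have L0 : 0 < d - c by rewrite subr_gt0.
have Lth0 : 0 < (d - c) `^ theta by exact: powR_gt0.
have cphi : {in `[c, d], continuous phi}.
  by move=> x /dphiP; exact: is_derive1_continuous.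
have il := integrableM_continuous cphi (integrable_powR_subl th0 cd).
have ir := integrableM_continuous cphi (integrable_powR_subr th0 cd).
rewrite !Rintegral_itv_oo_cc//.
set X := (X in _ * (X + _)); set Y := (Y in _ * (_ + Y)).
(* [psi] is [K' phi], so that [F' = (K phi)' - psi = K dphi] inside the interval. *)
pose psi x := theta * ((x - c) `^ (theta - 1) * phi x + (d - x) `^ (theta - 1) * phi x).
have ipsi : mu.-integrable `[c, d] (EFin \o psi).
  by apply: eq_integrable (integrableZl _ theta (integrableD _ il ir)) => //.
have psiE : \int[mu]_(x in `[c, d]) psi x = theta * (X + Y).
  rewrite /psi RintegralZl//; last by apply: eq_integrable (integrableD _ il ir).
  by rewrite RintegralD.
have cpsi : {in `]c, d[, continuous psi}.
  move=> x xcd; have /andP[cx xd] : c < x < d by move: xcd; rewrite in_itv.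
  have cphix := cphi x (subset_itv_oo_cc xcd).
  apply: continuousM_fun; first exact: cst_continuous.
  apply: continuousD_fun; apply: continuousM_fun => //.
    exact: continuous_powR_subl.
  exact: continuous_powR_subr.
have [Psi [cPsi dPsi Psic Psid]] := integrable_primitive cd ipsi cpsi.
pose K x := `|x - c| `^ theta - `|d - x| `^ theta.
pose F x := K x * phi x - Psi x.
have cK : continuous K.
  by move=> x; apply: continuousB_fun;
    [apply: continuous_normr_powR_subl|apply: continuous_normr_powR_subr]; exact: ltW.
have cF : {within `[c, d], continuous F}.
  have cKphi : {within `[c, d], continuous (fun x => K x * phi x)}.
    apply: continuous_in_subspaceT => x /set_mem xcd.
    by apply: continuousM_fun; [exact: cK|exact: cphi].
  move=> x; apply: (@continuousB _ _ (subspace `[c, d]) (fun x => K x * phi x) Psi).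
    exact: cKphi.
  exact: cPsi.
have dF : {in `]c, d[, forall x, is_derive x 1 F (K x * dphi x)}.
  move=> x xcd; have /andP[cx xd] : c < x < d by move: xcd; rewrite in_itv.
  have dK := is_derive1B_fun (is_derive1_normr_powR_subl theta cx)
    (is_derive1_normr_powR_subr theta xd).
  have dphix := dphiP x (subset_itv_oo_cc xcd).
  apply: is_derive_eq (is_derive1B_fun (is_derive1M_fun dK dphix) (dPsi x xcd)) _.
  by rewrite /K /psi; ring.
(* The orientation is reversed, [s 0 = d] and [s 1 = c], with [s - c = (d - c) (1 - t)] and
   [d - s = (d - c) t]. *)
pose s (t : R) : R := t * c + (1 - t) * d.
have ds (t : R) : is_derive t 1 s (c - d).
  have -> : s = fun t => d - (d - c) * t by apply/funext => y; rewrite /s; ring.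
  apply: is_derive_eq (is_derive1B_fun (is_derive_cst d t 1)
    (is_derive1Zl (d - c) (is_derive_id t 1))) _.
  by ring.
have scd t : 0 < t < 1 -> c < s t < d.
  by move=> /andP[t0 t1]; rewrite /s; apply/andP; split; nra.
have scd' t : 0 <= t <= 1 -> c <= s t <= d.
  by move=> /andP[t0 t1]; rewrite /s; apply/andP; split; nra.
have : `|F (s 1) - F (s 0)| <=
    \int[mu]_(t in `[0, 1]) ((d - c) * (d - c) `^ theta * g t).
  apply: (@ler_dist_integral _ (F \o s) (fun t => K (s t) * dphi (s t) * (c - d))) => //.
  - apply: (within_continuous_comp_sub cF) => [t|t /=].
      exact: is_derive1_continuous (ds t).
    by rewrite !in_itv/=; exact: scd'.
  - move=> t; rewrite in_itv/= => t01; apply: is_derive1_comp => //.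
    by apply: dF; rewrite in_itv/= scd.
  - apply: integrable_continuous_itv => t t01.
    apply: continuousM_fun; [exact: cst_continuous|exact: cg].
  - move=> t t01; apply: continuousM_fun; first exact: cst_continuous.
    exact/cg/subset_itv_oo_cc.
  - move=> t t01; have := gP t t01.
    have /andP[t0 t1] : 0 < t < 1 by move: t01; rewrite in_itv.
    have -> : K (s t) = (d - c) `^ theta * ((1 - t) `^ theta - t `^ theta).
      rewrite /K (_ : s t - c = (d - c) * (1 - t)); last by rewrite /s; ring.
      rewrite (_ : d - s t = (d - c) * t); last by rewrite /s; ring.
      have t1' : 0 <= 1 - t by lra.
      have [L0' t0'] := (ltW L0, ltW t0).
      by rewrite !ger0_norm ?mulr_ge0// !powRM// [RHS]mulrBr.
    rewrite !normrM [`|c - d|]distrC (gtr0_norm L0) (gtr0_norm Lth0) => gt.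
    (* Bounding the difference by the sum is the source of the two hypergeometric terms. *)
    have : `|(1 - t) `^ theta - t `^ theta| <= t `^ theta + (1 - t) `^ theta.
      have := powR_ge0 t theta; have := powR_ge0 (1 - t) theta.
      by rewrite ler_norml; lra.
    move=> /(ler_wpM2r (normr_ge0 (dphi (s t)))) h.
    have {h gt} := le_trans h gt.
    move=> /(ler_wpM2l (ltW (mulr_gt0 L0 Lth0))); apply: le_trans.
    by rewrite le_eqVlt; apply/orP; left; apply/eqP; ring.
rewrite RintegralZl//; last exact: integrable_continuous_itv.
have -> : s 1 = c by rewrite /s; ring.
have -> : s 0 = d by rewrite /s; ring.
set J := \int[mu]_(t in _) g t => FJ.
(* [K] takes the opposite values [- (d - c)^theta] at [c] and [(d - c)^theta] at [d], so the
   boundary terms of [F c - F d] add up; [Psi] contributes [theta (X + Y)]. *)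
have -> : (phi c + phi d) / 2 - theta / 2 * ((d - c) `^ theta)^-1 * (X + Y) =
    (F c - F d) * - (2 * (d - c) `^ theta)^-1.
  rewrite /F /K Psic Psid psiE !subrr normr0 powR0 ?gt_eqF// (gtr0_norm L0).
  by field; rewrite gt_eqF.
rewrite normrM normrN [`|_^-1|]gtr0_norm ?invr_gt0 ?mulr_gt0//.
rewrite ler_pdivrMr ?mulr_gt0//; apply: le_trans FJ _.
by rewrite le_eqVlt; apply/orP; left; apply/eqP; field.
Qed.

End fractional_trapezoid.

(** * Euler integrals and hypergeometric values *)

Section hypergeometric.
Context {R : realType}.
Notation mu := (@lebesgue_measure R).
Implicit Types (r s t z : R).

Lemma Rintegral_powR01 r : 0 <= r -> \int[mu]_(t in `[0, 1]) t `^ r = (r + 1)^-1.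
Proof.
move=> r0; have := Rintegral_powR_subl (ltr_wpDl r0 ltr01) (@ltr01 R).
rewrite subr0 powR1 addrK div1r => <-.
by apply: eq_Rintegral => t _; rewrite subr0.
Qed.

Lemma Rintegral_onem_powR01 r : 0 <= r ->
  \int[mu]_(t in `[0, 1]) (1 - t) `^ r = (r + 1)^-1.
Proof.
move=> r0; have := Rintegral_powR_subr (ltr_wpDl r0 ltr01) (@ltr01 R).
by rewrite subr0 powR1 addrK div1r.
Qed.

Lemma integrable_onem_powR01 r : 0 <= r ->
  mu.-integrable `[0, 1] (EFin \o (fun t => (1 - t) `^ r)).
Proof.
move=> r0; have := integrable_powR_subr (ltr_wpDl r0 ltr01) (@ltr01 R).
by rewrite addrK.
Qed.

Lemma integrable_powR01 r : 0 <= r ->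
  mu.-integrable `[0, 1] (EFin \o (fun t => t `^ r)).
Proof.
move=> r0; have := integrable_powR_subl (ltr_wpDl r0 ltr01) (@ltr01 R).
by rewrite addrK; apply: eq_integrable => // t _ /=; rewrite subr0.
Qed.

Lemma Beta_r1 r : 0 <= r -> Beta (r + 1) 1 = (r + 1)^-1.
Proof.
move=> r0; rewrite -Rintegral_powR01// /Beta -Rintegral_itv_oo_cc.
  by apply: eq_Rintegral => t _; rewrite addrK subrr powRr0 mulr1.
exact: integrable_powR01.
Qed.

Lemma Beta_1r r : 0 <= r -> Beta 1 (r + 1) = (r + 1)^-1.
Proof.
move=> r0; rewrite -Rintegral_onem_powR01// /Beta -Rintegral_itv_oo_cc.
  by apply: eq_Rintegral => t _; rewrite addrK subrr powRr0 mul1r.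
exact: integrable_onem_powR01.
Qed.

Lemma onemM_gt0 z t : 0 <= z < 1 -> 0 <= t <= 1 -> 0 < 1 - z * t.
Proof. by move=> /andP[z0 z1] /andP[t0 t1]; nra. Qed.

Lemma continuous_onemM_powR z s t : 0 <= z < 1 -> 0 <= t <= 1 ->
  continuous_at t (fun t => (1 - z * t) `^ s).
Proof.
move=> z01 t01; apply: continuous_powR_comp; first exact: onemM_gt0.
exact: is_derive1_continuous.
Qed.

Lemma integrable_powR_onemM z r s : 0 <= z < 1 -> 0 <= r ->
  mu.-integrable `[0, 1] (EFin \o (fun t => t `^ r * (1 - z * t) `^ s)).
Proof.
move=> z01 r0; apply: integrableM_continuous; last exact: integrable_powR01.
by move=> t; rewrite in_itv/= => t01; exact: continuous_onemM_powR.
Qed.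

Lemma integrable_onem_powR_onemM z r s : 0 <= z < 1 -> 0 <= r ->
  mu.-integrable `[0, 1] (EFin \o (fun t => (1 - t) `^ r * (1 - z * t) `^ s)).
Proof.
move=> z01 r0; apply: integrableM_continuous; last exact: integrable_onem_powR01.
by move=> t; rewrite in_itv/= => t01; exact: continuous_onemM_powR.
Qed.

(** The last two parameters differ by 1, so the factor in [1 - t] has exponent 0 and the Beta
    normalization is [1 / (r + 1)]. *)
Lemma hyp2F1_rD1 s r z : 0 <= z < 1 -> 0 <= r ->
  \int[mu]_(t in `[0, 1]) (t `^ r * (1 - z * t) `^ (- s)) =
  (r + 1)^-1 * hyp2F1 s (r + 1) (r + 2) z.
Proof.
move=> z01 r0; have r10 : 0 < r + 1 by rewrite ltr_wpDl.
rewrite /hyp2F1 (_ : r + 2 - (r + 1) = 1); last by ring.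
rewrite Beta_r1// invrK mulKf ?gt_eqF//.
rewrite -Rintegral_itv_oo_cc; last exact: integrable_powR_onemM.
by apply: eq_Rintegral => t _; rewrite addrK subrr powRr0 mulr1.
Qed.

(** Mirror case: the second parameter 1 removes the power of [t], with the same normalization. *)
Lemma hyp2F1_1rD1 s r z : 0 <= z < 1 -> 0 <= r ->
  \int[mu]_(t in `[0, 1]) ((1 - t) `^ r * (1 - z * t) `^ (- s)) =
  (r + 1)^-1 * hyp2F1 s 1 (r + 2) z.
Proof.
move=> z01 r0; have r10 : 0 < r + 1 by rewrite ltr_wpDl.
rewrite /hyp2F1 (_ : r + 2 - 1 = r + 1); last by ring.
rewrite Beta_1r// invrK mulKf ?gt_eqF//.
rewrite -Rintegral_itv_oo_cc; last exact: integrable_onem_powR_onemM.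
by apply: eq_Rintegral => t _; rewrite addrK subrr powRr0 mul1r.
Qed.

(** [powR] is nonnegative at every base, hence so are both integrands. This sign lets a [p]-th root
    be distributed over a product. *)
Lemma hyp2F1_ge0 s r (c z : R) : 0 <= hyp2F1 s r c z.
Proof.
rewrite /hyp2F1 mulr_ge0//.
  by rewrite invr_ge0; apply: Rintegral_ge0 => t _; rewrite mulr_ge0 ?powR_ge0.
by apply: Rintegral_ge0 => t _; rewrite !mulr_ge0 ?powR_ge0.
Qed.

(** Hoelder is applied to [k (1 - z t)^(- 2)] and [w^(1 / q)]. The absolute value on [w], harmless
    on [[0, 1]], keeps the root continuous where [w] may be negative. *)
Lemma hoelder_onemM_le (k w : R -> R) (p q z : R) : 0 <= z < 1 ->
  continuous k -> continuous w ->
  {in `[0, 1], forall t, 0 <= k t} -> {in `[0, 1], forall t, 0 <= w t} ->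
  0 < p -> 0 < q -> p^-1 + q^-1 = 1 ->
  \int[mu]_(t in `[0, 1]) (k t * (1 - z * t) `^ (- 2) * `|w t| `^ (1 / q)) <=
  (\int[mu]_(t in `[0, 1]) (k t `^ p * (1 - z * t) `^ (- (2 * p)))) `^ (1 / p) *
  (\int[mu]_(t in `[0, 1]) w t) `^ (1 / q).
Proof.
move=> z01 ck cw k0 w0 p0 q0 pq.
have cker : {in `[0, 1], continuous (fun t => k t * (1 - z * t) `^ (- 2))}.
  move=> t; rewrite in_itv/= => t01; apply: continuousM_fun.
    exact: ck.
  exact: continuous_onemM_powR.
have cwq : continuous (fun t => `|w t| `^ (1 / q)).
  by move=> t; apply: continuous_normr_powR_comp => //; rewrite div1r invr_ge0 ltW.
have meas (f : R -> R) : {in `[0, 1], continuous f} -> measurable_fun (`[0, 1] : set R) f.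
  move=> cf; apply: subspace_continuous_measurable_fun => //.
  by apply: continuous_in_subspaceT => t /set_mem; exact: cf.
have ker0 t : `[0, 1]%classic t -> 0 <= k t * (1 - z * t) `^ (- 2).
  by move=> t01; rewrite mulr_ge0 ?powR_ge0// k0.
have kerp t : `[0, 1]%classic t -> (k t * (1 - z * t) `^ (- 2)) `^ p =
    k t `^ p * (1 - z * t) `^ (- (2 * p)).
  by move=> t01; rewrite powRM ?powR_ge0 ?k0// -powRrM mulNr.
have wqq t : `[0, 1]%classic t -> (`|w t| `^ (1 / q)) `^ q = w t.
  move=> t01; rewrite -powRrM div1r mulVf ?gt_eqF// powRr1// ger0_norm//.
  exact: w0.
have -> : \int[mu]_(t in `[0, 1]) (k t `^ p * (1 - z * t) `^ (- (2 * p))) =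
    \int[mu]_(t in `[0, 1]) (k t * (1 - z * t) `^ (- 2)) `^ p.
  by apply: eq_Rintegral => t /set_mem t01; rewrite kerp.
have -> : \int[mu]_(t in `[0, 1]) w t =
    \int[mu]_(t in `[0, 1]) (`|w t| `^ (1 / q)) `^ q.
  by apply: eq_Rintegral => t /set_mem t01; rewrite wqq.
apply: Rintegral_hoelder => //.
- exact: meas.
- by apply: meas => t _; exact: cwq.
- apply: eq_integrable (@integrable_continuous_itv R
    (fun t => `|k t * (1 - z * t) `^ (- 2)| `^ p) 0 1 _) => //.
    by move=> t /set_mem t01 /=; rewrite ger0_norm// ker0.
  move=> t t01; apply: continuous_normr_powR_comp; first exact: ltW.
  exact: cker.
- apply: eq_integrable (@integrable_continuous_itv R w 0 1 _) => //.
  by move=> t /set_mem t01 /=; rewrite wqq.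
- apply: integrable_continuous_itv => t t01.
  by apply: continuousM_fun; [exact: cker|exact: cwq].
Qed.

End hypergeometric.

(** * Reduction of the functional to integrals and the final estimate *)

Lemma interior_itv_mem {R : realType} (I : set R) u v x : is_interval I ->
  I° u -> I° v -> u <= x <= v -> I° x.
Proof.
move=> itvI Iu Iv /andP[]; rewrite le_eqVlt => /predU1P[<-//|ux].
rewrite le_eqVlt => /predU1P[->//|xv].
(* For [x] strictly between [u] and [v], the neighbourhood []u, v[] lies in [I] because [I] is an
   interval. *)
have : nbhs x `]u, v[%classic by apply: near_in_itvoo; rewrite in_itv/= ux.
apply: filterS => y /=; rewrite in_itv/= => /andP[uy yv].
by apply: (itvI u v); rewrite ?ltW//; exact: interior_subset.
Qed.

Lemma powR_le_root {R : realType} (x y q : R) : 0 <= x -> 0 < q ->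
  x `^ q <= y -> x <= y `^ (1 / q).
Proof.
move=> x0 q0 xy; have {1}-> : x = (x `^ q) `^ (1 / q).
  by rewrite -powRrM div1r divff ?gt_eqF// powRr1.
apply: ge0_ler_powR; rewrite ?nnegrE ?powR_ge0//.
- by rewrite div1r invr_ge0 ltW.
- by apply: le_trans xy; exact: powR_ge0.
Qed.

(** [Gamma theta] cancels by the recurrence, and [a b / (b - a)] is the reciprocal of the length
    [1/a - 1/b]. [f b] comes first because [1/b] is the left endpoint. *)
Lemma I_f_Gamma_free {R : realType} (f : R -> R) (theta a b : R) :
  0 < theta -> 0 < a -> a < b ->
  I_f f theta a b = (f b + f a) / 2 - theta / 2 * ((a^-1 - b^-1) `^ theta)^-1 *
    (\int[lebesgue_measure]_(x in `]b^-1, a^-1[)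
       ((x - b^-1) `^ (theta - 1) * f x^-1) +
     \int[lebesgue_measure]_(x in `]b^-1, a^-1[)
       ((a^-1 - x) `^ (theta - 1) * f x^-1)).
Proof.
move=> th0 a0 ab; have b0 : 0 < b by exact: lt_trans ab.
have G0 := Gamma_gt0 th0.
rewrite /I_f /RL_right /RL_left GammaD1//= [f a + f b]addrC.
have -> : (a * b / (b - a)) `^ theta = ((a^-1 - b^-1) `^ theta)^-1.
  rewrite (_ : a * b / (b - a) = (a^-1 - b^-1)^-1); last first.
    by field; rewrite mulN1r !gt_eqF ?subr_gt0.
  have L0 : 0 <= a^-1 - b^-1 by rewrite subr_ge0 lef_pV2 ?posrE// ltW.
  by rewrite -powR_inv1// -powRrM mulN1r powRN.
have L0 : 0 < (a^-1 - b^-1) `^ theta by rewrite powR_gt0 ?subr_gt0 ?ltf_pV2.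
rewrite -mulrDr mulrA; congr (_ - _ * _).
by field; rewrite !gt_eqF.
Qed.

Theorem theorem7 (R : realType) (I : set R) (f : R -> R)
  (m alpha p q theta a b : R) :
  is_interval I -> I `<=` `]0, +oo[ ->
  (forall x, interior I x -> derivable f x 1) ->
  0 < m -> m <= 1 -> 0 <= alpha -> alpha <= 1 ->
  1 < q -> p^-1 + q^-1 = 1 -> 0 < theta ->
  a < b -> interior I a -> interior I (b / m) ->
  (@lebesgue_measure R).-integrable `[a, b] (EFin \o (derive1 f)) ->
  harm_alpha_m_convex alpha m (fun x => `|(derive1 f) x| `^ q) `[a, b / m] ->
  `|I_f f theta a b| <=
    a * (b - a) / (2 * b) * (1 / (theta * p + 1)) `^ (1 / p) *
    ((`|(derive1 f) a| `^ q + m * alpha * `|(derive1 f) (b / m)| `^ q) / (alpha + 1)) `^ (1 / q) *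
    ((hyp2F1 (2 * p) (theta * p + 1) (theta * p + 2) (1 - a / b)) `^ (1 / p) +
     (hyp2F1 (2 * p) 1 (theta * p + 2) (1 - a / b)) `^ (1 / p)).
Proof.
move=> itvI Ipos dfI m0 m1 al0 al1 q1 pq th0 ab Ia Ibm _ cvx.
have a0 : 0 < a by have /Ipos := interior_subset Ia; rewrite /= in_itv/= andbT.
have b0 : 0 < b by exact: lt_trans ab.
have q0 : 0 < q by exact: lt_trans q1.
have p0 : 0 < p.
  by rewrite -invr_gt0 -(addrK q^-1 p^-1) pq subr_gt0 invf_lt1.
have bm : b <= b / m by rewrite ler_pdivlMr// ler_piMr// ltW.
have df x : a <= x <= b -> is_derive x 1 f (derive1 f x).
  move=> /andP[ax xb]; rewrite derive1E; apply/derivableP/dfI.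
  by apply: (interior_itv_mem itvI Ia Ibm); rewrite ax (le_trans xb).
set A := `|derive1 f a| `^ q; set B := `|derive1 f (b / m)| `^ q.
have A0 : 0 <= A by exact: powR_ge0.
have B0 : 0 <= B by exact: powR_ge0.
(* With this [z] the substitution reads [s = t / b + (1 - t) / a = (1 - z t) / a], and [z < 1] keeps
   [1 - z t] positive on [[0, 1]]. *)
pose z : R := 1 - a / b.
have z01 : 0 <= z < 1.
  by rewrite /z subr_ge0 ler_pdivrMr// mul1r ltW//= gtrBl divr_gt0.
(* This is the convexity bound at parameter [1 - t]; the absolute values make it continuous across
   [t = 1]. *)
pose w (t : R) : R := `|1 - t| `^ alpha * A + m * (1 - `|1 - t| `^ alpha) * B.
have cpow1 (r : R) : 0 <= r -> continuous (fun t : R => `|1 - t| `^ r).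
  exact: continuous_normr_powR_subr.
have cw : continuous w.
  move=> t; apply: continuousD_fun.
    by apply: continuousM_fun; [exact: cpow1|exact: cst_continuous].
  apply: continuousM_fun; last exact: cst_continuous.
  apply: continuousM_fun; first exact: cst_continuous.
  by apply: continuousB_fun; [exact: cst_continuous|exact: cpow1].
have w0 : {in `[0, 1], forall t, 0 <= w t}.
  move=> t; rewrite in_itv/= => /andP[t0 t1].
  have le1 : `|1 - t| `^ alpha <= 1.
    have : `|1 - t| `^ alpha <= 1 `^ alpha; last by rewrite powR1.
    apply: ge0_ler_powR; rewrite ?nnegrE//.
    by rewrite ger0_norm ?subr_ge0//; lra.
  by rewrite addr_ge0// !mulr_ge0 ?powR_ge0 ?subr_ge0// ltW.
have wE : \int[lebesgue_measure]_(t in `[0, 1]) w t =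
    (A + m * alpha * B) / (alpha + 1).
  have i1 := integrable_onem_powR01 al0.
  have i2 := @integrable_powR01 R 0 (lexx _).
  (* Writing 1 as [t^0] turns both terms into power integrals, with total
     [(A - m B) / (alpha + 1) + m B]. *)
  transitivity (\int[lebesgue_measure]_(t in `[0, 1])
      ((A - m * B) * (1 - t) `^ alpha + m * B * t `^ 0)).
    apply: eq_Rintegral => t /set_mem/=; rewrite in_itv/= => /andP[t0 t1].
    by rewrite /w powRr0 ger0_norm ?subr_ge0//; ring.
  have j1 : lebesgue_measure.-integrable `[0, 1]
      (EFin \o (fun t : R => (A - m * B) * (1 - t) `^ alpha)).
    by apply: eq_integrable (integrableZl _ (A - m * B) i1).
  have j2 : lebesgue_measure.-integrable `[0, 1]
      (EFin \o (fun t : R => m * B * t `^ 0)).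
    by apply: eq_integrable (integrableZl _ (m * B) i2).
  rewrite RintegralD//.
  rewrite !RintegralZl// Rintegral_onem_powR01// Rintegral_powR01//.
  by field; rewrite gt_eqF// ltr_wpDl.
pose G (k : R -> R) (t : R) : R := k t * (1 - z * t) `^ (- 2) * `|w t| `^ (1 / q).
have cG (k : R -> R) : continuous k -> {in `[0, 1], continuous (G k)}.
  move=> ck t; rewrite in_itv/= => t01.
  apply: continuousM_fun; last first.
    apply: continuous_normr_powR_comp; last exact: cw.
    by rewrite div1r invr_ge0 ltW.
  by apply: continuousM_fun; [exact: ck|exact: continuous_onemM_powR].
have f'le (t : R) : 0 < t < 1 ->
    `|derive1 f (t * b^-1 + (1 - t) * a^-1)^-1| <= `|w t| `^ (1 / q).
  move=> /andP[t0 t1]; have t01 : t \in `[0, 1] by rewrite in_itv/= !ltW.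
  have D0 : 0 < t * a + (1 - t) * b by nra.
  have m0' := lt0r_neq0 m0; have a0' := lt0r_neq0 a0.
  have b0' := lt0r_neq0 b0; have D0' := lt0r_neq0 D0.
  have -> : (t * b^-1 + (1 - t) * a^-1)^-1 = a * b / (t * a + (1 - t) * b).
    by field; rewrite b0' a0' D0'.
  (* At the points [a] and [b / m] with parameter [1 - t], the factor [m] cancels and the convexity
     argument is exactly [1 / s], which lies in [[a, b]]. *)
  have argE : m * a * (b / m) / (m * (1 - t) * (b / m) + (1 - (1 - t)) * a) =
      a * b / (t * a + (1 - t) * b).
    by field; rewrite m0' D0'.
  have aD : a <= a * b / (t * a + (1 - t) * b)
    by rewrite ler_pdivlMr// ler_pM2l//; nra.
  have Db : a * b / (t * a + (1 - t) * b) <= b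
    by rewrite ler_pdivrMr// mulrC ler_pM2l//; nra.
  apply: powR_le_root => //; rewrite [`|w t|]ger0_norm ?w0//.
  have h := cvx a (b / m) (1 - t); rewrite argE in h.
  rewrite /w [`|1 - t|]gtr0_norm ?subr_gt0//; apply: h.
  - by rewrite /= in_itv/= lexx (le_trans (ltW ab)).
  - by rewrite /= in_itv/= lexx (le_trans (ltW ab)).
  - by lra.
  - by rewrite /= in_itv/= aD (le_trans Db).
rewrite I_f_Gamma_free//.
have -> : f b = (f \o GRing.inv) b^-1 by rewrite /= invrK.
have -> : f a = (f \o GRing.inv) a^-1 by rewrite /= invrK.
pose k1 (t : R) : R := `|t| `^ theta.
pose k2 (t : R) : R := `|1 - t| `^ theta.
have ck1 : continuous k1 by apply: continuous_normr_powR; exact: ltW.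
have ck2 : continuous k2 by apply: cpow1; exact: ltW.
(* The derivative of [f (1/s)] carries [s^(- 2) = a^2 (1 - z t)^(- 2)]: hence the factor [a^2] here
   and the kernel in [G]. *)
apply: le_trans (@fractional_trapezoid_le R theta b^-1 a^-1 (f \o GRing.inv)
  (fun x => derive1 f x^-1 * - x ^- 2)
  (fun t => a ^+ 2 * (G k1 t + G k2 t)) th0 _ _ _ _) _.
- by rewrite ltf_pV2 ?posrE.
- move=> x; rewrite in_itv/= => /andP[bx xa].
  have x0 : 0 < x by rewrite (lt_le_trans _ bx)// invr_gt0.
  have dinv : is_derive x 1 (fun y : R => y^-1) (- x ^- 2).
    apply: is_derive_eq (@is_deriveV R id x 1 1 _ _) _; first by rewrite gt_eqF.
    by rewrite /GRing.scale/= mulr1.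
  apply: (@is_derive1_comp R f GRing.inv) dinv; apply: df.
  by rewrite -[a]invrK -[b]invrK !lef_pV2 ?posrE ?invr_gt0// xa bx.
- move=> t t01; apply: continuousM_fun; first exact: cst_continuous.
  by apply: continuousD_fun; exact: cG.
- move=> t; rewrite in_itv/= => t01; have /andP[t0 t1] := t01.
  have zt0 : 0 < 1 - z * t by apply: onemM_gt0 => //; rewrite !ltW.
  have sE : t * b^-1 + (1 - t) * a^-1 = (1 - z * t) / a.
    by rewrite /z; field; rewrite !gt_eqF.
  have := f'le t t01; rewrite sE => h.
  rewrite /G /k1 /k2 (gtr0_norm t0) [`|1 - t|]gtr0_norm ?subr_gt0//.
  rewrite normrM normrN [`|_ ^- 2|]gtr0_norm ?invr_gt0 ?exprn_gt0 ?divr_gt0//.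
  rewrite (powR_invn 2 (ltW zt0)).
  set K := _ `^ theta + _; have K0 : 0 <= K by rewrite addr_ge0 ?powR_ge0.
  have zt0' := lt0r_neq0 zt0; have a0' := lt0r_neq0 a0.
  have -> : K * (`|derive1 f ((1 - z * t) / a)^-1| * ((1 - z * t) / a) ^- 2) =
      K * (a ^+ 2 / (1 - z * t) ^+ 2) * `|derive1 f ((1 - z * t) / a)^-1|.
    by field; rewrite zt0'.
  rewrite -mulrDl -mulrDl -/K.
  apply: (@le_trans _ _ (K * (a ^+ 2 / (1 - z * t) ^+ 2) * `|w t| `^ (1 / q))).
    by rewrite ler_wpM2l// mulr_ge0// divr_ge0// exprn_ge0// ltW.
  by rewrite le_eqVlt; apply/orP; left; apply/eqP; ring.
have iG (k : R -> R) : continuous k ->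
    lebesgue_measure.-integrable `[0, 1] (EFin \o G k).
  by move=> ck; apply: integrable_continuous_itv; exact: cG.
rewrite RintegralZl//; last first.
  by apply: eq_integrable (integrableD _ (iG _ ck1) (iG _ ck2)).
rewrite RintegralD//; [|exact: iG|exact: iG].
have r0 : 0 <= theta * p by rewrite mulr_ge0// ltW.
have r1 : 0 < theta * p + 1 by rewrite ltr_wpDl.
(* Raising [t^theta (1 - z t)^(- 2)] to the power [p] gives exponents [theta p] and [- 2 p], an
   Euler integral; [L2] treats the kernel in [1 - t] likewise. *)
have L1 : \int[lebesgue_measure]_(t in `[0, 1]) G k1 t <=
    ((theta * p + 1)^-1 *
      hyp2F1 (2 * p) (theta * p + 1) (theta * p + 2) z) `^ (1 / p) *
    ((A + m * alpha * B) / (alpha + 1)) `^ (1 / q).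
  rewrite -wE -hyp2F1_rD1//.
  have -> : \int[lebesgue_measure]_(t in `[0, 1])
      (t `^ (theta * p) * (1 - z * t) `^ (- (2 * p))) =
      \int[lebesgue_measure]_(t in `[0, 1])
      (k1 t `^ p * (1 - z * t) `^ (- (2 * p))).
    apply: eq_Rintegral => t /set_mem/=; rewrite in_itv/= => /andP[t0 _].
    by rewrite /k1 ger0_norm// -powRrM.
  apply: (hoelder_onemM_le z01 ck1 cw _ w0 p0 q0 pq) => t _.
  exact: powR_ge0.
have L2 : \int[lebesgue_measure]_(t in `[0, 1]) G k2 t <=
    ((theta * p + 1)^-1 * hyp2F1 (2 * p) 1 (theta * p + 2) z) `^ (1 / p) *
    ((A + m * alpha * B) / (alpha + 1)) `^ (1 / q).
  rewrite -wE -hyp2F1_1rD1//.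
  have -> : \int[lebesgue_measure]_(t in `[0, 1])
      ((1 - t) `^ (theta * p) * (1 - z * t) `^ (- (2 * p))) =
      \int[lebesgue_measure]_(t in `[0, 1])
      (k2 t `^ p * (1 - z * t) `^ (- (2 * p))).
    apply: eq_Rintegral => t /set_mem/=; rewrite in_itv/= => /andP[_ t1].
    by rewrite /k2 ger0_norm ?subr_ge0// -powRrM.
  apply: (hoelder_onemM_le z01 ck2 cw _ w0 p0 q0 pq) => t _.
  exact: powR_ge0.
have ri0 : 0 <= (theta * p + 1)^-1 by rewrite invr_ge0 ltW.
move: L1 L2; rewrite !(powRM _ ri0 (hyp2F1_ge0 _ _ _ _)) => L1 L2.
rewrite -/z [1 / (theta * p + 1)]div1r mulrA.
(* Half the length of [[1/b, 1/a]] times the factor [a^2] from the inversion gives the leading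
   constant. *)
have -> : (a^-1 - b^-1) / 2 * a ^+ 2 = a * (b - a) / (2 * b).
  by field; rewrite !gt_eqF.
have C0 : 0 <= a * (b - a) / (2 * b).
  by rewrite divr_ge0 ?mulr_ge0 ?subr_ge0// ltW.
apply: le_trans (ler_wpM2l C0 (lerD L1 L2)) _.
have factor (C r H1 H2 W : R) :
    C * (r * H1 * W + r * H2 * W) = C * r * W * (H1 + H2) by ring.
by rewrite factor.
Qed.
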